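(* Assume the standing assumptions of the context ($X$, $U$ compact; $\ell$, $g$ and $L_fv$ for all $v\in C^1([t_0,T]\times X)$ continuous; trial-induced measures of uniformly bounded total mass). Fix a partition $\Pi=\{\tau_0=t_0<\tau_1<\dots<\tau_K=T\}$ and segmented-rollout families $\Theta_\Pi^{(M)}$, $M\ge1$. Suppose (i) (nested capacity) $\Theta_\Pi^{(M)}\subseteq\Theta_\Pi^{(M+1)}$ for all $M\ge1$; (ii) (asymptotic density) for every exact OM-feasible pair $(\mu,\mu_T)$ there exists a sequence $\theta_M\in\Theta_\Pi^{(M)}$ such that, as $M\to\infty$, $(\mu_{\theta_M},\mu_{T,\theta_M})\to(\mu,\mu_T)$ weak-$\star$, $D_{\theta_M}\to0$, and $E_{\theta_M}\to0$. Then $$\lim_{\delta\downarrow0}\ \lim_{\eta\downarrow0}\ \lim_{M\to\infty}P^{\mathrm{imp}}_{\Pi,M}(\eta,\delta)=P.$$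
   Context: Setting. Let $t_0<T$, $X\subset\mathbb R^n$ and $U\subset\mathbb R^{d}$ compact, $Z:=[t_0,T]\times X\times U$, dynamics $f:Z\to\mathbb R^n$, running cost $\ell:Z\to\mathbb R$, terminal cost $g:X\to\mathbb R$. $\mathcal V:=C^1([t_0,T]\times X)$ with its usual norm $\|v\|_{C^1}$ (sup norms of $v$ and its first derivatives); for $v\in\mathcal V$, $(L_fv)(t,x,u):=\partial_tv(t,x)+\nabla_xv(t,x)^\top f(t,x,u)$. It is assumed that $\ell$, $g$, and $L_fv$ (for all $v\in\mathcal V$) are continuous. $\mathcal M_+(\cdot)$ denotes finite nonnegative Borel measures, $\langle\phi,\rho\rangle:=\int\phi\,d\rho$, and $\mu_0\in\mathcal M_+(\{t_0\}\times X)$ is fixed; measures on $\{t_0\}\times X$ are identified with measures on $X$. Weak-$\star$ convergence of measures is against continuous functions. Exact OM linear program: a pair $(\mu,\mu_T)\in\mathcal M_+(Z)\times\mathcal M_+(\{T\}\times X)$ is exact OM-feasible if $\langle v,\mu_T-\mu_0\rangle=\langle L_fv,\mu\rangle$ for all $v\in\mathcal V$; $P$ is the infimum of $\langle\ell,\mu\rangle+\langle g,\mu_T\rangle$ over such pairs. Segmented-rollout families: for each $M\ge 1$, $\Theta_\Pi^{(M)}$ is a set of finite-dimensional parameters; each $\theta$ (independently of $M$) produces, for $k=0,\dots,K-1$, measures $\mu_{\theta,k}\in\mathcal M_+([\tau_k,\tau_{k+1}]\times X\times U)$ and $\nu_{\theta,k}^+,\nu_{\theta,k+1}^-\in\mathcal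 M_+(X)$ (state distributions at the start and the end of segment $k$), with $\nu_{\theta,0}^+=\mu_0$. The induced global pair is $\mu_\theta:=\sum_{k=0}^{K-1}\mu_{\theta,k}$, $\mu_{T,\theta}:=\delta_T\otimes\nu_{\theta,K}^-$, with total masses bounded uniformly over all $\theta\in\bigcup_M\Theta_\Pi^{(M)}$. Cost: $J(\theta):=\langle\ell,\mu_\theta\rangle+\langle g,\mu_{T,\theta}\rangle$. Interface defects: $d_{\theta,k}:=\nu_{\theta,k}^+-\nu_{\theta,k}^-$, $k=1,\dots,K-1$. Local rollout residuals: $e_{\theta,k}(v):=\langle v(\tau_{k+1},\cdot),\nu_{\theta,k+1}^-\rangle-\langle v(\tau_k,\cdot),\nu_{\theta,k}^+\rangle-\langle L_fv,\mu_{\theta,k}\rangle$, $k=0,\dots,K-1$. Let $\|\cdot\|_{\mathrm{def}}$ be a norm on finite signed Borel measures on $X$ whose dual norm $\|\phi\|_{\mathrm{def},*}:=\sup_{\|\sigma\|_{\mathrm{def}}\le1}|\langle\phi,\sigma\rangle|$ is a (finite) norm on $C(X)$. Define $$D_\theta:=\sum_{k=1}^{K-1}\|d_{\theta,k}\|_{\mathrm{def}},\qquad E_\theta:=\sup_{\|v\|_{C^1}\le1}\Big|\sum_{k=0}^{K-1}e_{\theta,k}(v)\Big|.$$ For $\eta,\delta>0$: $P^{\mathrm{imp}}_{\Pi,M}(\eta,\delta):=\inf\{J(\theta):\theta\in\Theta_\Pi^{(M)},\ D_\theta\le\eta,\ E_\theta\le\delta\}$. Infima over empty sets are $+\infty$.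 *)

(* Defs.v *)
(* The reals are an arbitrary [R : realType], R^n is
   ['rV[R]_n], time-state points are pairs (t, x) and time-state-control points
   are left-nested triples ((t, x), u).

   A measure (or a function) on a compact subset D of a euclidean space is
   encoded as a Borel measure (or a function) on the whole space: measures are
   required to vanish outside D, and functions are only integrated over D and
   only required to be continuous on D, for the subspace topology. *)
From HB Require Import structures.
From mathcomp Require Import all_boot all_order all_algebra.
From mathcomp Require Import all_classical all_reals all_analysis.
Import Order.TTheory GRing.Theory Num.Theory.
Import numFieldNormedType.Exports.

Set Implicit Arguments.
Unset Strict Implicit.
Unset Printing Implicit Defensive.

Local Open Scope classical_set_scope.
Local Open Scope ring_scope.

Notation borel T := (g_sigma_algebraType (@open T)).
Notation timestate R n := (R * 'rV[R]_n)%type.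
Notation occspace R n d := (R * 'rV[R]_n * 'rV[R]_d)%type.

Definition concentrated {R : realType} {T : normedModType R} (D : set T)
    (mu : {measure set (borel T) -> \bar R}) : Prop :=
  mu (~` D) = 0%E.

Definition pairing {R : realType} {T : normedModType R} (D : set T)
    (phi : T -> R) (mu : {measure set (borel T) -> \bar R}) : R :=
  (\int[mu]_(z in (D : set (borel T))) phi z)%R.

Definition weak_star_cvg {R : realType} {T : normedModType R} (D : set T)
    (mu_ : nat -> {measure set (borel T) -> \bar R})
    (mu : {measure set (borel T) -> \bar R}) : Prop :=
  forall phi : T -> R, {within D, continuous phi} ->
    pairing D phi (mu_ M) @[M --> \oo] --> pairing D phi mu.

Section C1.
Context {R : realType} {n : nat}.
Implicit Types (v : timestate R n -> R) (A : set (timestate R n)).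

Definition dt v (z : timestate R n) : R := 'D_(1, 0) v z.
Definition dx v (i : 'I_n) (z : timestate R n) : R := 'D_(0, delta_mx 0 i) v z.

(* As A may have empty interior, a C^1 function on A is a function which is C^1
   on an open neighbourhood of A; its derivatives on A are those of this
   function. *)
Definition C1_on A v : Prop :=
  exists O : set (timestate R n), [/\ open O, A `<=` O &
    forall z, O z -> [/\ differentiable v z, {for z, continuous (dt v)} &
                         forall i, {for z, continuous (dx v i)}]].

Definition sup_norm A (h : timestate R n -> R) : R :=
  sup [set `|h z| | z in A].

Definition C1_norm A v : R :=
  sup_norm A v + sup_norm A (dt v) + \sum_(i < n) sup_norm A (dx v i).

End C1.

Section SignedMeasures.
Context {R : realType} {n : nat}.
Local Notation smeas := (charge (borel 'rV[R]_n) R) (only parsing).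
Local Notation fmeas := (FiniteMeasure.type (borel 'rV[R]_n) R) (only parsing).

Definition charge_on (X : set 'rV[R]_n) (s : smeas) : Prop :=
  forall A : set (borel 'rV[R]_n), measurable A -> A `<=` ~` X -> s A = 0%E.

(* Integral against a signed measure, through its Jordan decomposition. *)
Definition charge_pairing (X : set 'rV[R]_n) (phi : 'rV[R]_n -> R)
    (s : smeas) : R :=
  let pos := cid (Hahn_decomposition s) in
  let neg := cid (projT2 pos) in
  pairing X phi (jordan_pos (projT2 neg)) -
  pairing X phi (jordan_neg (projT2 neg)).

Definition charge_sub (mu nu : fmeas) : smeas :=
  cadd (charge_of_finite_measure mu) (copp (charge_of_finite_measure nu)).

(* [measure_norm_ext] says that N is a function of the signed measure alone: a
   charge of the library may take arbitrary values on non-measurable sets. *)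
Record is_measure_norm (X : set 'rV[R]_n) (N : smeas -> R) : Prop := {
  measure_norm_ext : forall s s' : smeas, charge_on X s -> charge_on X s' ->
    (forall A : set (borel 'rV[R]_n), measurable A -> s A = s' A) -> N s = N s';
  measure_norm_ge0 : forall s : smeas, charge_on X s -> 0 <= N s;
  measure_norm_eq0 : forall s : smeas, charge_on X s -> N s = 0 ->
    forall A : set (borel 'rV[R]_n), measurable A -> s A = 0%E;
  measure_normZ : forall (r : R) (s : smeas), charge_on X s ->
    N (cscale r s) = `|r| * N s;
  measure_normD : forall s s' : smeas, charge_on X s -> charge_on X s' ->
    N (cadd s s') <= N s + N s' }.

Definition dual_norm (X : set 'rV[R]_n) (N : smeas -> R)
    (phi : 'rV[R]_n -> R) : \bar R :=
  ereal_sup [set `|charge_pairing X phi s|%:E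
            | s in [set s : smeas | charge_on X s /\ N s <= 1]].

Record is_finite_norm_on_continuous (X : set 'rV[R]_n)
    (q : ('rV[R]_n -> R) -> \bar R) : Prop := {
  continuous_norm_fin : forall phi : 'rV[R]_n -> R,
    {within X, continuous phi} -> q phi \is a fin_num;
  continuous_norm_ge0 : forall phi : 'rV[R]_n -> R,
    {within X, continuous phi} -> (0 <= q phi)%E;
  continuous_norm_eq0 : forall phi : 'rV[R]_n -> R,
    {within X, continuous phi} -> q phi = 0%E -> forall x, X x -> phi x = 0;
  continuous_normZ : forall (r : R) (phi : 'rV[R]_n -> R),
    {within X, continuous phi} ->
    q (fun x => r * phi x) = (`|r|%:E * q phi)%E;
  continuous_normD : forall phi psi : 'rV[R]_n -> R,
    {within X, continuous phi} -> {within X, continuous psi} ->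
    (q (fun x => (phi x + psi x)%R) <= q phi + q psi)%E }.

End SignedMeasures.

(* Measures on {t0} x X and on {tT} x X are identified with measures on X; in
   particular [mu0] and all terminal measures are measures on X. *)
Record om_problem (R : realType) (n d : nat) := OMProblem {
  t0 : R;
  tT : R;
  stateset : set 'rV[R]_n;
  controlset : set 'rV[R]_d;
  dynamics : occspace R n d -> 'rV[R]_n;
  running : occspace R n d -> R;
  terminal : 'rV[R]_n -> R;
  mu0 : {finite_measure set (borel 'rV[R]_n) -> \bar R} }.

Section OM.
Context {R : realType} {n d : nat} (pb : om_problem R n d).
Local Notation X := (stateset pb).
Local Notation U := (controlset pb).

Definition cylinder : set (timestate R n) := `[t0 pb, tT pb]%classic `*` X.

Definition Z : set (occspace R n d) := cylinder `*` U.

Definition Lf (v : timestate R n -> R) (z : occspace R n d) : R :=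
  dt v z.1 + \sum_(i < n) dx v i z.1 * dynamics pb z 0 i.

Record standing_assumptions : Prop := {
  horizon : t0 pb < tT pb;
  stateset_compact : compact X;
  controlset_compact : compact U;
  running_continuous : {within Z, continuous (running pb)};
  terminal_continuous : {within X, continuous (terminal pb)};
  Lf_continuous : forall v, C1_on cylinder v -> {within Z, continuous (Lf v)};
  mu0_concentrated : concentrated X (mu0 pb) }.

Definition cost (mu : {measure set (borel (occspace R n d)) -> \bar R})
    (muT : {measure set (borel 'rV[R]_n) -> \bar R}) : R :=
  pairing Z (running pb) mu + pairing X (terminal pb) muT.

Definition exact_feasible
    (mu : {finite_measure set (borel (occspace R n d)) -> \bar R})
    (muT : {finite_measure set (borel 'rV[R]_n) -> \bar R}) : Prop :=
  [/\ concentrated Z mu, concentrated X muT &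
      forall v, C1_on cylinder v ->
        pairing X (fun x => v (tT pb, x)) muT -
        pairing X (fun x => v (t0 pb, x)) (mu0 pb) = pairing Z (Lf v) mu].

Definition OM_value : \bar R :=
  ereal_inf [set c | exists mu muT,
                       exact_feasible mu muT /\ c = (cost mu muT)%:E].

End OM.

Record is_partition {R : realType} (a b : R) (K : nat) (tau : nat -> R) :
    Prop := {
  partition_first : tau 0%N = a;
  partition_last : tau K = b;
  partition_increasing : forall k, (k < K)%N -> tau k < tau k.+1 }.

(* [occ r k], k < K: occupation measure of segment k;
   [start r k], k < K: state distribution at the start of segment k;
   [stop r k.+1], k < K: state distribution at the end of segment k.
   The values at other indices are never used. *)
Record rollout (R : realType) (n d : nat) := Rollout {
  occ : nat -> {finite_measure set (borel (occspace R n d)) -> \bar R};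
  start : nat -> {finite_measure set (borel 'rV[R]_n) -> \bar R};
  stop : nat -> {finite_measure set (borel 'rV[R]_n) -> \bar R} }.

Section Rollouts.
Context {R : realType} {n d : nat} (pb : om_problem R n d).
Context (K : nat) (tau : nat -> R).
Implicit Types r : rollout R n d.
Local Notation X := (stateset pb).
Local Notation U := (controlset pb).

Record is_rollout r : Prop := {
  occ_concentrated : forall k, (k < K)%N ->
    concentrated (`[tau k, tau k.+1]%classic `*` X `*` U) (occ r k);
  start_concentrated : forall k, (k < K)%N -> concentrated X (start r k);
  stop_concentrated : forall k, (k < K)%N -> concentrated X (stop r k.+1);
  start_initial : forall A : set (borel 'rV[R]_n), measurable A ->
    start r 0%N A = mu0 pb A }.

Definition global_occ r : {measure set (borel (occspace R n d)) -> \bar R} :=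
  msum (fun k => occ r k) K.

Definition global_terminal r : {measure set (borel 'rV[R]_n) -> \bar R} :=
  stop r K.

Definition rollout_cost r : R := cost pb (global_occ r) (global_terminal r).

Definition interface_defect r (k : nat) :
    {charge set (borel 'rV[R]_n) -> \bar R} :=
  charge_sub (start r k) (stop r k).

Definition total_defect
    (N : {charge set (borel 'rV[R]_n) -> \bar R} -> R) r : R :=
  \sum_(1 <= k < K) N (interface_defect r k).

Definition local_residual r (k : nat) (v : timestate R n -> R) : R :=
  pairing X (fun x => v (tau k.+1, x)) (stop r k.+1) -
  pairing X (fun x => v (tau k, x)) (start r k) -
  pairing (Z pb) (Lf pb v) (occ r k).

Definition total_residual r : \bar R :=
  ereal_sup [set `|\sum_(0 <= k < K) local_residual r k v|%:E
            | v in [set v | C1_on (cylinder pb) v /\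
                            C1_norm (cylinder pb) v <= 1]].

Context {Par : Type} (roll : Par -> rollout R n d) (Theta : nat -> set Par).

Definition P_imp (N : {charge set (borel 'rV[R]_n) -> \bar R} -> R)
    (M : nat) (eta delta : R) : \bar R :=
  ereal_inf [set (rollout_cost (roll theta))%:E
            | theta in [set theta | [/\ Theta M theta,
                total_defect N (roll theta) <= eta &
                (total_residual (roll theta) <= delta%:E)%E]]].

Record is_rollout_family : Prop := {
  family_rollout : forall M theta, (1 <= M)%N -> Theta M theta ->
    is_rollout (roll theta);
  family_mass_bounded : exists C : R, forall M theta,
    (1 <= M)%N -> Theta M theta ->
    (global_occ (roll theta) setT <= C%:E)%E /\
    (global_terminal (roll theta) setT <= C%:E)%E }.

Definition nested_capacity : Prop :=
  forall M, (1 <= M)%N -> Theta M `<=` Theta M.+1.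

Definition asymptotically_dense
    (N : {charge set (borel 'rV[R]_n) -> \bar R} -> R) : Prop :=
  forall mu muT, exact_feasible pb mu muT ->
    exists theta : nat -> Par,
      [/\ forall M, (1 <= M)%N -> Theta M (theta M),
          weak_star_cvg (Z pb) (fun M => global_occ (roll (theta M))) mu,
          weak_star_cvg X (fun M => global_terminal (roll (theta M))) muT,
          total_defect N (roll (theta M)) @[M --> \oo] --> (0 : R) &
          total_residual (roll (theta M)) @[M --> \oo] --> (0 : \bar R)%E].

End Rollouts.

(* Main.v *)
(* Monotonicity makes every limit an infimum or a supremum, and density bounds
   the iterated limit by P from above.

   For the lower bound, take rollouts whose tolerances eta = delta = 1/(j+1)
   vanish and whose costs stay below c.  Summing the local residuals telescopes
   up to the interface defects, and the dual norm controls the latter, so the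
   global pairs are asymptotically feasible.  A weak-star limit is then exactly
   feasible with cost at most c.

   The weak-star limit is taken along an ultrafilter F on the index set, which
   avoids extracting subsequences.  The limits lam(A) = lim_F m_j(A) exist for
   all Borel sets and define a finitely additive lam; the set function
   rho(O) = sup {lam(D) : D closed, D included in O} on open sets generates an
   outer measure for which open sets are Caratheodory measurable, and the
   resulting Borel measure mu satisfies mu(O) <= lam(O) on open sets and
   mu(T) = lam(T).  A layer-cake argument turns these two facts into convergence
   of the integrals of continuous functions. *)
From HB Require Import structures.
Require Import Defs.
From mathcomp Require Import all_boot all_order all_algebra.
From mathcomp Require Import all_classical all_reals all_analysis.
From mathcomp Require Import measurable_realfun lra.
Import Order.TTheory GRing.Theory Num.Theory.
Import numFieldNormedType.Exports.
Local Open Scope classical_set_scope.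
Local Open Scope ring_scope.

Set Implicit Arguments.
Unset Strict Implicit.
Unset Printing Implicit Defensive.

(** * Weak-star limits along ultrafilters *)

(* [ler_cvg_to] asks for a topology on the index type. *)
Lemma ler_cvg_index {R : realType} {I : Type} {F : set_system I}
    {PF : ProperFilter F} (f g : I -> R) (a b : R) :
  f j @[j --> F] --> a -> g j @[j --> F] --> b -> (forall j, f j <= g j) ->
  a <= b.
Proof.
move=> fa gb fg; rewrite -subr_ge0.
have gfba : g j - f j @[j --> F] --> b - a by exact: cvgB.
rewrite -(cvg_lim _ gfba); last exact: (@norm_hausdorff R R^o).
apply: limr_ge; first by apply/cvg_ex; exists (b - a).
by apply: nearW => j; rewrite subr_ge0.
Qed.

Section ultrafilter_limits.
Context {R : realType} {I : Type} {F : set_system I} {UF : UltraFilter F}.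

Lemma ultra_bounded_cvg (f : I -> R) (B : R) :
  (forall j, `|f j| <= B) -> cvg (f j @[j --> F]).
Proof.
move=> fB; apply/cvg_ex.
have fBF : (f @ F) `[- B, B]%classic.
  by apply: (filterE (F := F)) => j; rewrite /= in_itv/= -ler_norml.
have [p [_ clp]] := @segment_compact R (- B) B (f @ F) _ fBF.
exists p => V pV.
have [//|FnV] := in_ultra_setVsetC (f @^-1` V) UF.
by have [z [nVz Vz]] := clp (~` V) V FnV pV.
Qed.

End ultrafilter_limits.

Section borel_of_normed.
Context {R : realType} {T : normedModType R}.

Lemma open_borel (A : set T) : open A -> measurable (A : set (borel T)).
Proof. exact: sub_sigma_algebra. Qed.

Lemma closed_borel (A : set T) : closed A -> measurable (A : set (borel T)).
Proof.
by move=> /closed_openC/open_borel/measurableC; rewrite setCK.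
Qed.

Lemma compact_borel (A : set T) : compact A -> measurable (A : set (borel T)).
Proof. by move/(compact_closed (@norm_hausdorff R T))/closed_borel. Qed.

Lemma closed_subsetU_split (C A B : set T) : closed C -> open A -> open B ->
  C `<=` A `|` B ->
  exists C1 C2, [/\ closed C1, closed C2, C1 `<=` A, C2 `<=` B & C = C1 `|` C2].
Proof.
move=> cC oA oB CAB.
have [|||U [V [oU oV CU CV UV0]]] :=
    (@normal_openP R T).1 pseudometric_normal (C `\` A) (C `\` B).
- by apply: closedI => //; exact: open_closedC.
- by apply: closedI => //; exact: open_closedC.
- by rewrite -subset0 => x [[Cx nA] [_ nB]]; have [] := CAB _ Cx.
exists (C `\` U), (C `\` V); split.
- by apply: closedI => //; exact: open_closedC.
- by apply: closedI => //; exact: open_closedC.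
- by move=> x [Cx nU]; apply: contrapT => nA; apply: nU; exact: CU.
- by move=> x [Cx nV]; apply: contrapT => nB; apply: nV; exact: CV.
- rewrite eqEsubset; split => [x Cx|x [] []//].
  have [Ux|nUx] := pselect (U x); last by left.
  by right; split => // Vx; have : (U `&` V) x by []; rewrite UV0.
Qed.

Lemma finite_mass_fin_num (mu : {measure set (borel T) -> \bar R})
    (A : set (borel T)) :
  (mu setT < +oo)%E -> measurable A -> mu A \is a fin_num.
Proof.
move=> muT mA; rewrite ge0_fin_numE//; apply: le_lt_trans muT.
by apply: le_measure; rewrite ?inE.
Qed.

Lemma mass_bound (mu : {measure set (borel T) -> \bar R}) (C : R)
    (A : set (borel T)) :
  (mu setT <= C%:E)%E -> measurable A -> `|fine (mu A)| <= C.
Proof.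
move=> muC mA; rewrite ger0_norm ?fine_ge0// -lee_fin fineK.
  by apply: le_trans muC; apply: le_measure; rewrite ?inE.
by apply: finite_mass_fin_num => //; exact: le_lt_trans muC (ltry C).
Qed.

End borel_of_normed.

Section weak_star_compactness.
Context {R : realType} {T : normedModType R} {I : Type} {F : set_system I}
  {UF : UltraFilter F}.
Variables (m : I -> {measure set (borel T) -> \bar R}) (C : R) (K : set T).
Hypotheses (mC : forall j, (m j setT <= C%:E)%E) (cK : compact K)
  (mK : forall j, concentrated K (m j)).

Let lam (A : set (borel T)) : R := lim (fine (m j A) @[j --> F]).

Let m_fin j (A : set (borel T)) : measurable A -> m j A \is a fin_num.
Proof. by apply: finite_mass_fin_num; exact: le_lt_trans (mC j) (ltry C). Qed.

Let lam_cvg (A : set (borel T)) : measurable A ->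
  fine (m j A) @[j --> F] --> lam A.
Proof. by move=> mA; apply: ultra_bounded_cvg => j; exact: mass_bound. Qed.

Let lam_ge0 (A : set (borel T)) : measurable A -> 0 <= lam A.
Proof.
move=> mA; apply: limr_ge; first exact: lam_cvg.
by apply: nearW => j; rewrite fine_ge0.
Qed.

Let lam_le (A B : set (borel T)) : measurable A -> measurable B ->
  A `<=` B -> lam A <= lam B.
Proof.
move=> mA mB AB.
apply: (@ler_cvg_index R I F _ (fun j => fine (m j A)) (fun j => fine (m j B)));
  [exact: lam_cvg|exact: lam_cvg|move=> j].
apply: fine_le; rewrite ?m_fin//.
by apply: le_measure; rewrite ?inE.
Qed.

Let lamU (A B : set (borel T)) : measurable A -> measurable B ->
  A `&` B = set0 -> lam (A `|` B) = lam A + lam B.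
Proof.
move=> mA mB AB.
apply: (@cvg_unique _ (@norm_hausdorff R R^o) (fine (m j (A `|` B)) @[j --> F])).
  by apply: lam_cvg; exact: measurableU.
rewrite (_ : (fun j => _) = (fun j => fine (m j A) + fine (m j B))); last first.
  by apply/funext => j; rewrite measureU// fineD// m_fin.
by apply: cvgD; exact: lam_cvg.
Qed.

Let lamU_le (A B : set (borel T)) : measurable A -> measurable B ->
  lam (A `|` B) <= lam A + lam B.
Proof.
move=> mA mB; have -> : A `|` B = (A `\` B) `|` B.
  rewrite eqEsubset; split => [x|x [[Ax _]|Bx]]; [|by left|by right].
  by have [Bx|nBx] := pselect (B x); [right|case=> // Ax; left].
have mAB : measurable (A `\` B) by exact: measurableD.
rewrite lamU//; last by rewrite -subset0 => x [[_ ?]].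
by rewrite lerD2r lam_le// => x [].
Qed.

Let lam_null (A : set (borel T)) : (forall j, m j A = 0%E) -> lam A = 0.
Proof.
move=> mA; rewrite /lam (_ : (fun j => _) = (fun=> 0)); last first.
  by apply/funext => j; rewrite mA.
by apply: lim_cst; exact: (@norm_hausdorff R R^o).
Qed.

Let lam_nullC : lam (~` K) = 0.
Proof. exact: lam_null. Qed.

Let lamIK (A : set (borel T)) : measurable A -> lam A <= lam (A `&` K).
Proof.
move=> mA; have mmK : measurable (K : set (borel T)) by exact: compact_borel.
have mAK : measurable (A `&` K) by exact: measurableI.
have mKC : measurable (~` K : set (borel T)) by exact: measurableC.
have := lamU_le mAK mKC; rewrite lam_nullC addr0; apply: le_trans.
apply: lam_le => //; first exact: measurableU.
by move=> x Ax; have [Kx|nKx] := pselect (K x); [left|right].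
Qed.

(* The inner regular content of the limit, only used on open sets. *)
Let rho (O : set T) : \bar R :=
  ereal_sup [set (lam D)%:E | D in [set D : set T | closed D /\ D `<=` O]].

Let mu (A : set T) : \bar R :=
  ereal_inf [set rho O | O in [set O : set T | open O /\ A `<=` O]].

Let lam_rho (D O : set T) : closed D -> D `<=` O -> ((lam D)%:E <= rho O)%E.
Proof. by move=> cD DO; apply: ereal_sup_ubound; exists D. Qed.

Let rho_lam (O : set T) : open O -> (rho O <= (lam O)%:E)%E.
Proof.
move=> oO; apply: ge_ereal_sup => _ [D [cD DO] <-].
by rewrite lee_fin lam_le//; [exact: closed_borel|exact: open_borel].
Qed.

Let rho_ge0 (O : set T) : (0 <= rho O)%E.
Proof.
apply: le_trans (lam_rho closed0 (@sub0set _ _)).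
by rewrite lee_fin lam_ge0.
Qed.

Let le_rho (O O' : set T) : O `<=` O' -> (rho O <= rho O')%E.
Proof.
move=> OO'; apply: ge_ereal_sup => _ [D [cD DO] <-].
by apply: lam_rho => //; exact: subset_trans OO'.
Qed.

Let lam_le_sum_rho (O : nat -> set T) n (D : set T) : (forall i, open (O i)) ->
  closed D -> D `<=` \bigcup_(i < n) O i ->
  ((lam D)%:E <= \sum_(0 <= i < n) rho (O i))%E.
Proof.
move=> oO; elim: n D => [|n IHn] D cD DO.
  rewrite bigcup_mkord big_ord0 in DO; rewrite big_nil lee_fin.
  have -> : D = set0 by rewrite -subset0.
  by rewrite lam_null// => j; rewrite measure0.
have [||||C1 [C2 [cC1 cC2 C1O C2O ->]]] :=
    @closed_subsetU_split R T D (\bigcup_(i < n) O i) (O n).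
- exact: cD.
- exact: bigcup_open.
- exact: oO.
- move=> x /DO[i /=]; rewrite ltnS leq_eqVlt => /orP[/eqP ->|ltin] Ox.
    by right.
  by left; exists i.
rewrite big_nat_recr//=; apply: le_trans (leeD (IHn _ cC1 C1O) (lam_rho cC2 C2O)).
by rewrite -EFinD lee_fin lamU_le//; exact: closed_borel.
Qed.

Let rho_bigcup (O : nat -> set T) : (forall i, open (O i)) ->
  (rho (\bigcup_i O i) <= \sum_(i <oo) rho (O i))%E.
Proof.
move=> oO; apply: ge_ereal_sup => _ [D [cD DO] <-].
have cDK : compact (D `&` K) by rewrite setIC; exact: compact_closedI.
move: (cDK); rewrite compact_cover => /(_ nat setT O) [] //.
  by move=> x [/DO].
move=> D' _ DD'; pose n := (\max_(i <- finmap.enum_fset D') i).+1.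
apply: (@le_trans _ _ (\sum_(0 <= i < n) rho (O i))%E); last first.
  by apply: nneseries_lim_ge => i _ _; exact: rho_ge0.
apply: (@le_trans _ _ (lam (D `&` K))%:E).
  by rewrite lee_fin lamIK//; exact: closed_borel.
apply: lam_le_sum_rho => //.
  by apply: closedI => //; exact: compact_closed (@norm_hausdorff R T) _.
move=> x /DD'[i /= iD' Ox]; exists i => //=.
by rewrite ltnS; exact: (@leq_bigmax_seq _ (finmap.enum_fset D') xpredT id i iD').
Qed.

Let mu_open (O : set T) : open O -> mu O = rho O.
Proof.
move=> oO; apply/le_anti/andP; split.
  by apply: ereal_inf_lbound; exists O => //; split.
by apply: le_ereal_inf_tmp => _ [W [_ OW] <-]; exact: le_rho.
Qed.

Let mu_ge0 (A : set T) : (0 <= mu A)%E.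
Proof. by apply: le_ereal_inf_tmp => _ [W [_ OW] <-]; exact: rho_ge0. Qed.

Let mu0 : mu set0 = 0%E.
Proof.
rewrite mu_open; last exact: open0.
apply/le_anti; rewrite rho_ge0 andbT; apply: le_trans (rho_lam open0) _.
by rewrite lam_null// => j; rewrite measure0.
Qed.

Let le_mu : {homo mu : A B / A `<=` B >-> (A <= B)%E}.
Proof.
move=> A B AB; apply: le_ereal_inf_tmp => _ [G [oG BG] <-].
by apply: ereal_inf_lbound; exists G => //; split => //; exact: subset_trans BG.
Qed.

Let mu_fin (A : set T) : mu A \is a fin_num.
Proof.
rewrite ge0_fin_numE//; apply: le_lt_trans (ltry (lam setT)).
apply: (@le_trans _ _ (mu setT)); first exact: le_mu.
by rewrite mu_open; [apply: rho_lam|]; exact: openT.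
Qed.

Let mu_sigma_subadditive : sigma_subadditive mu.
Proof.
move=> A; apply/lee_addgt0Pr => e e0.
have /choice[W WP] : forall i, exists G, [/\ open G, A i `<=` G &
    (rho G <= mu (A i) + (e / (2 ^ i.+1)%:R)%:E)%E].
  move=> i; have ei0 : 0 < e / (2 ^ i.+1)%:R.
    by rewrite divr_gt0// ltr0n expn_gt0.
  have [_ [G [oG AG] <-] Ge] := lb_ereal_inf_adherent ei0 (mu_fin (A i)).
  by exists G; split => //; exact: ltW.
apply: le_trans (epsilon_trick _ _ (ltW e0)) => //.
apply: (@le_trans _ _ (\sum_(i <oo) rho (W i))%E); last first.
  by apply: lee_nneseries => i; [move=> _ _; exact: rho_ge0|move=> _; have [] := WP i].
apply: le_trans (rho_bigcup _); last by move=> i; have [] := WP i.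
apply: ereal_inf_lbound; exists (\bigcup_i W i) => //; split.
  by apply: bigcup_open => i _; have [] := WP i.
by apply: subset_bigcup => i _; have [] := WP i.
Qed.

Let mu_outer : {outer_measure set T -> \bar R} :=
  HB.pack mu (isOuterMeasure.Build R T mu mu0 mu_ge0 le_mu mu_sigma_subadditive).

Let mu_caratheodory (A : set (borel T)) : measurable A -> mu_outer.-caratheodory A.
Proof.
have : smallest (sigma_algebra setT) open `<=` mu_outer.-caratheodory.
  apply: smallest_sub.
    split; first exact: caratheodory_measurable_set0.
      by move=> B; rewrite setTD; exact: caratheodory_measurable_setC.
    exact: caratheodory_measurable_bigcup.
  move=> G oG; apply: le_caratheodory_measurable => X /=.
  apply: le_ereal_inf_tmp => _ [W [oW XW] <-].
  apply: (@le_trans _ _ (mu (W `&` G) + mu (W `&` ~` G))%E).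
    by apply: leeD; apply: le_mu; exact: setSI.
  rewrite mu_open; last exact: openI.
  rewrite -leeBrDr//; apply: ge_ereal_sup => _ [D [cD DW] <-].
  rewrite leeBrDr// addeC -leeBrDr//.
  apply: (@le_trans _ _ (mu (W `\` D))).
    by apply: le_mu => x [Wx nGx]; split => // /DW[].
  rewrite mu_open; last by apply: openI => //; exact: closed_openC.
  apply: ge_ereal_sup => _ [D' [cD' D'W] <-].
  rewrite leeBrDr// -EFinD -lamU.
  - apply: lam_rho; first exact: closedU.
    by move=> x [/D'W[]|/DW[]].
  - exact: closed_borel.
  - exact: closed_borel.
  - by rewrite -subset0 => x [/D'W[]].
by move=> /(_ A).
Qed.

Let mu_sigma_additive : semi_sigma_additive (mu : set (borel T) -> \bar R).
Proof.
move=> A mA tA mUA.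
by apply: (@caratheodory_measure_sigma_additive R T mu_outer) => //;
  [move=> i; exact: (mu_caratheodory (mA i))|exact: (mu_caratheodory mUA)].
Qed.

Let mu_measure : {measure set (borel T) -> \bar R} :=
  HB.pack (mu : set (borel T) -> \bar R)
    (isMeasure.Build _ (borel T) R mu mu0 mu_ge0 mu_sigma_additive).

Lemma ultra_limit_measure :
  exists nu : {finite_measure set (borel T) -> \bar R},
    [/\ concentrated K nu,
        fine (m j setT) @[j --> F] --> fine (nu setT) &
        forall (O : set T) (l : R), open O ->
          fine (m j O) @[j --> F] --> l -> fine (nu O) <= l].
Proof.
have mu_fin_num : fin_num_fun mu_measure by move=> A _; exact: mu_fin.
pose nu : {finite_measure set (borel T) -> \bar R} :=
  HB.pack (mu : set (borel T) -> \bar R) (Measure.class mu_measure)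
    (@Measure_isFinite.Build _ (borel T) R mu_measure mu_fin_num).
exists nu; split.
- have oKC : open (~` K).
    by apply: closed_openC; exact: compact_closed (@norm_hausdorff R T) _.
  apply/le_anti; rewrite measure_ge0 andbT.
  rewrite [leLHS](mu_open oKC); apply: le_trans (rho_lam oKC) _.
  by rewrite lam_nullC.
- have -> : fine (nu setT) = lam setT.
    rewrite /= mu_open; last exact: openT.
    have -> : rho setT = (lam setT)%:E.
      apply/le_anti/andP; split; first by apply: rho_lam; exact: openT.
      by apply: lam_rho => //; exact: closedT.
    by [].
  exact: lam_cvg.
- move=> O l oO ml; have -> : l = lam O.
    apply: (@cvg_unique _ (@norm_hausdorff R R^o) (fine (m j O) @[j --> F])) => //.
    by apply: lam_cvg; exact: open_borel.
  by rewrite -lee_fin fineK ?mu_fin//= mu_open// rho_lam.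
Qed.

End weak_star_compactness.

Section pairing_theory.
Context {R : realType} {T : normedModType R} (K : set T).
Hypothesis cK : compact K.
Implicit Types (phi psi : T -> R) (mu nu : {measure set (borel T) -> \bar R}).

Lemma within_continuous_preimage phi (V : set R) : {within K, continuous phi} ->
  open V -> exists2 U : set T, open U & K `&` phi @^-1` V = K `&` U.
Proof.
move=> /continuousP cphi /cphi /open_subspaceP[U oU UK].
by exists U => //; rewrite [RHS]setIC UK setIC.
Qed.

Lemma within_continuous_measurable phi : {within K, continuous phi} ->
  measurable_fun (K : set (borel T)) phi.
Proof.
move=> cphi mK; apply: (measurability _ (RGenOInfty.measurableE R)); last exact: mK.
move=> _ [_ [a ->] <-].
have oa : open (`]a, +oo[%classic : set R) by exact: interval_open.
have [U oU ->] := within_continuous_preimage cphi oa.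
by apply: measurableI; [exact: mK|exact: open_borel].
Qed.

Lemma within_continuous_bounded phi : {within K, continuous phi} ->
  exists2 B : R, 0 < B & forall x, K x -> `|phi x| <= B.
Proof.
move=> cphi; have /compact_bounded[B [_ /(_ (`|B| + 1)) HB]] := continuous_compact cphi cK.
exists (`|B| + 1); first by rewrite ltr_pwDr.
by move=> x Kx; apply: HB; [rewrite ltr_pwDr// ler_norm|exists x].
Qed.

Lemma bounded_integrable mu (f : T -> R) (B : R) : (mu setT < +oo)%E ->
  measurable_fun (K : set (borel T)) f -> (forall x, K x -> `|f x| <= B) ->
  mu.-integrable (K : set (borel T)) (EFin \o f).
Proof.
move=> muT mf fB; have mK := compact_borel cK.
apply: measurable_bounded_integrable => //.
  by apply: le_lt_trans muT; apply: le_measure; rewrite ?inE.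
exists B; split; first exact: num_real.
by move=> b Bb x Kx; apply: le_trans (ltW Bb); exact: fB.
Qed.

Lemma within_continuous_integrable mu phi : (mu setT < +oo)%E ->
  {within K, continuous phi} ->
  mu.-integrable (K : set (borel T)) (EFin \o phi).
Proof.
move=> muT cphi; have [B _ phiB] := within_continuous_bounded cphi.
exact: bounded_integrable (within_continuous_measurable cphi) phiB.
Qed.

Lemma concentrated_measureI mu (A : set (borel T)) : concentrated K mu ->
  measurable A -> mu (A `&` K) = mu A.
Proof.
move=> muK mA; have mK := compact_borel cK.
rewrite [RHS](measureDI _ mA mK) [X in _ = (X + _)%E](_ : _ = 0%E) ?add0e//.
by apply: subset_measure0 muK; [exact: measurableD|exact: measurableC|move=> x []].
Qed.

Lemma pairingZ mu phi (r : R) : (mu setT < +oo)%E ->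
  {within K, continuous phi} ->
  pairing K (fun x => r * phi x) mu = r * pairing K phi mu.
Proof.
move=> muT cphi; apply: RintegralZl; first exact: compact_borel.
exact: within_continuous_integrable.
Qed.

Lemma pairing_measure_add mu nu phi : (mu setT < +oo)%E -> (nu setT < +oo)%E ->
  {within K, continuous phi} ->
  pairing K phi (measure_add mu nu) = pairing K phi mu + pairing K phi nu.
Proof.
move=> muT nuT cphi; have mK := compact_borel cK.
have imu := within_continuous_integrable muT cphi.
have inu := within_continuous_integrable nuT cphi.
rewrite /pairing /Rintegral (integral_measure_add mK imu inu).
by rewrite fineD//; exact: integrable_fin_num.
Qed.

Lemma eq_pairing_measure mu nu phi :
  (forall A : set (borel T), measurable A -> mu A = nu A) ->
  pairing K phi mu = pairing K phi nu.
Proof.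
move=> munu; congr fine; apply: eq_measure_integral => A mA _.
exact: munu.
Qed.

Lemma pairing_msum (m : nat -> {measure set (borel T) -> \bar R}) n phi :
  (forall k, (k < n)%N -> (m k setT < +oo)%E) -> {within K, continuous phi} ->
  pairing K phi (msum m n) = \sum_(0 <= k < n) pairing K phi (m k).
Proof.
move=> + cphi; elim: n => [|n IHn] mT.
  rewrite big_nil /pairing /Rintegral (eq_measure_integral mzero).
    by rewrite integral_measure_zero.
  by move=> A _ _; rewrite /= /msum big_ord0.
have mT' k : (k < n)%N -> (m k setT < +oo)%E by move=> kn; apply/mT/ltnW.
have -> : pairing K phi (msum m n.+1) =
          pairing K phi (measure_add (msum m n) (m n)).
  by apply: eq_pairing_measure => A _; rewrite /= /msum !big_ord_recr/= big_ord0 add0e.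
rewrite pairing_measure_add//; last exact: mT.
  by rewrite IHn// big_nat_recr.
by rewrite /= /msum; apply: lte_sum_pinfty => k _; exact: mT'.
Qed.

Lemma pairing_mscale mu phi (r : {nonneg R}) : (mu setT < +oo)%E ->
  {within K, continuous phi} ->
  pairing K phi (mscale r mu) = r%:num * pairing K phi mu.
Proof.
move=> muT cphi; have mK := compact_borel cK.
have imu := within_continuous_integrable muT cphi.
have mphi : measurable_fun (K : set (borel T)) (EFin \o phi).
  by apply/measurable_EFinP; exact: within_continuous_measurable.
rewrite /pairing /Rintegral integralE [in RHS]integralE.
rewrite !ge0_integral_mscale//; [|exact: measurable_funeneg|exact: measurable_funepos].
have fpos := integrable_fin_num mK (integrable_funepos mK imu).
have fneg := integrable_fin_num mK (integrable_funeneg mK imu).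
by rewrite -(fineK fpos) -(fineK fneg) -!EFinM -!EFinB /= mulrBr.
Qed.

End pairing_theory.

Lemma staircase_bounds {R : realType} (e y : R) n :
  0 < e -> 0 <= y -> y <= n%:R * e ->
  y <= \sum_(0 <= k < n) e * (k%:R * e < y)%R%:R <= y + e.
Proof.
move=> e0 y0; elim: n => [|n IHn] yn.
  rewrite mul0r in yn; rewrite big_nil.
  by rewrite yn addr_ge0// ltW.
have [yn'|ny] := leP y (n%:R * e).
  by rewrite big_nat_recr//= ltNge yn' /= mulr0 addr0 IHn.
have -> : \sum_(0 <= k < n.+1) e * (k%:R * e < y)%R%:R = n.+1%:R * e.
  rewrite (eq_big_nat _ _ (F2 := fun=> e)).
    by rewrite big_const_nat iter_addr addr0 subn0 mulr_natl.
  move=> k /andP[_ kn]; rewrite (_ : _ < _ = true) ?mulr1//.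
  by apply: le_lt_trans ny; rewrite ler_pM2r// ler_nat.
by rewrite yn -natr1 mulrDl mul1r lerD2r ltW.
Qed.

Lemma pairing_sum_indic {R : realType} {T : normedModType R} (K : set T)
    (mu : {measure set (borel T) -> \bar R}) (e : R)
    (U : nat -> set (borel T)) n :
  compact K -> (mu setT < +oo)%E -> concentrated K mu ->
  (forall k, measurable (U k)) ->
  mu.-integrable (K : set (borel T))
    (EFin \o (fun x => \sum_(0 <= k < n) e * \1_(U k) x)) /\
  pairing K (fun x => \sum_(0 <= k < n) e * \1_(U k) x) mu =
  \sum_(0 <= k < n) e * fine (mu (U k)).
Proof.
move=> cK muT muK mU; have mK := compact_borel cK.
have iU k : mu.-integrable (K : set (borel T)) (EFin \o (\1_(U k) : T -> R)).
  apply: (@bounded_integrable _ _ _ cK _ _ 1) => //.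
  by move=> x _; rewrite indicE ger0_norm// lern1 leq_b1.
have ieU k : mu.-integrable (K : set (borel T)) (EFin \o (fun x => e * \1_(U k) x)).
  exact: (integrableZl mK e (iU k)).
elim: n => [|n [IHi IHe]].
  rewrite big_nil; split.
    apply: (eq_integrable mK _ _ _ (integrable0 mu K)) => x _.
    by rewrite /= big_nil.
  rewrite /pairing (@eq_Rintegral _ _ _ mu K (fun=> 0)).
    by rewrite Rintegral_cst// mul0r.
  by move=> x _; rewrite big_nil.
have eS : (fun x : T => \sum_(0 <= k < n.+1) e * (\1_(U k) x : R)) =
          (fun x => \sum_(0 <= k < n) e * \1_(U k) x + e * \1_(U n) x).
  by apply/funext => x; rewrite big_nat_recr.
rewrite eS; split; first exact: (integrableD mK IHi (ieU n)).
rewrite big_nat_recr//= -IHe /pairing RintegralD//.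
rewrite RintegralZl//; congr (_ + e * _).
by rewrite /Rintegral integral_indic// concentrated_measureI.
Qed.

Section ultra_limit_pairing.
Context {R : realType} {T : normedModType R} {I : Type} {F : set_system I}
  {UF : UltraFilter F}.
Variables (m : I -> {measure set (borel T) -> \bar R}) (C : R) (K : set T).
Hypotheses (mC : forall j, (m j setT <= C%:E)%E) (cK : compact K)
  (mK : forall j, concentrated K (m j)).
Variable nu : {finite_measure set (borel T) -> \bar R}.
Hypotheses (nuK : concentrated K nu)
  (mnuT : fine (m j setT) @[j --> F] --> fine (nu setT))
  (mnu_open : forall (O : set T) (l : R), open O ->
     fine (m j O) @[j --> F] --> l -> fine (nu O) <= l).

Let mT j : (m j setT < +oo)%E. Proof. exact: le_lt_trans (mC j) (ltry _). Qed.

Let nuT : (nu setT < +oo)%E.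
Proof. by rewrite -ge0_fin_numE//; exact: fin_num_measure. Qed.

Let C_ge0 : 0 <= C.
Proof.
have [j _] := @filter_ex _ F _ _ (filterT : F setT).
by rewrite -lee_fin; apply: le_trans (mC j).
Qed.

(* A staircase built on the open superlevel sets of [phi] turns the inequality
   on open sets into one on integrals. *)
Let pairing_limit_le (phi : T -> R) (l : R) : {within K, continuous phi} ->
  (forall x, K x -> 0 <= phi x) ->
  pairing K phi (m j) @[j --> F] --> l -> pairing K phi nu <= l.
Proof.
move=> cphi phi0 ml; have mmK := compact_borel cK.
have [B B0 phiB] := within_continuous_bounded cK cphi.
suff H e : 0 < e -> pairing K phi nu <= l + e * C.
  apply/ler_addgt0Pr => e e0.
  have C1 : 0 < C + 1 by rewrite ltr_wpDl.
  apply: le_trans (H (e / (C + 1)) _) _; first exact: divr_gt0.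
  rewrite lerD2l mulrAC ler_pdivrMr// ler_pM2l//.
  by rewrite lerDl.
move=> e0; pose n := Num.bound (B / e).
have Bn : B <= n%:R * e.
  rewrite -ler_pdivrMr// ltW//; apply: archi_boundP.
  by rewrite divr_ge0// ltW.
have /choice[U UP] : forall k : nat, exists U : set T,
    open U /\ K `&` phi @^-1` `]k%:R * e, +oo[%classic = K `&` U.
  move=> k; have oke : open (`]k%:R * e, +oo[%classic : set R) by exact: interval_open.
  by have [U oU UE] := within_continuous_preimage cphi oke; exists U.
have mU k : measurable (U k : set (borel T)) by apply: open_borel; have [] := UP k.
have UE x k : K x -> (\1_(U k) x : R) = (k%:R * e < phi x)%R%:R.
  move=> Kx; rewrite indicE; congr (_%:R); congr nat_of_bool.
  have [_ /seteqP[h1 h2]] := UP k; apply/idP/idP.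
    by rewrite inE => Ux; have [_ /=] := h2 x (conj Kx Ux); rewrite in_itv/= andbT.
  move=> ltx; rewrite inE; have [] // := h1 x; split => //=.
  by rewrite in_itv/= andbT.
pose s x := \sum_(0 <= k < n) e * (\1_(U k) x : R).
have sP x : K x -> phi x <= s x <= phi x + e.
  move=> Kx; rewrite /s (eq_bigr (fun k => e * (k%:R * e < phi x)%R%:R)); last first.
    by move=> k _; rewrite UE.
  apply: staircase_bounds => //; first exact: phi0.
  by apply: le_trans Bn; apply: le_trans (phiB _ Kx); exact: ler_norm.
have [inu nuE] := @pairing_sum_indic _ _ K nu e U n cK nuT nuK mU.
have iphi mu := @within_continuous_integrable _ _ _ cK mu phi.
apply: (@le_trans _ _ (pairing K s nu)).
  apply: le_Rintegral => //; first exact: iphi.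
  by move=> x /sP/andP[].
rewrite nuE.
pose L k := lim (fine (m j (U k)) @[j --> F]).
have mL k : fine (m j (U k)) @[j --> F] --> L k.
  by apply: ultra_bounded_cvg => j; exact: mass_bound.
apply: (@le_trans _ _ (\sum_(0 <= k < n) e * L k)).
  apply: ler_sum => k _; rewrite ler_pM2l//.
  by apply: mnu_open; [have [] := UP k|exact: mL].
apply: (@ler_cvg_index R I F _ (fun j => pairing K s (m j))
  (fun j => pairing K phi (m j) + e * C)).
- have -> : (fun j => pairing K s (m j)) =
            (fun j => \sum_(0 <= k < n) e * fine (m j (U k))).
    apply/funext => j.
    by have [_ ->] := @pairing_sum_indic _ _ K (m j) e U n cK (mT j) (mK j) mU.
  apply: cvg_big => [|k _]; first exact: add_continuous.
  by apply: cvgM; [exact: cvg_cst|exact: mL].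
- by apply: cvgD => //; exact: cvg_cst.
- move=> j.
  have [ij _] := @pairing_sum_indic _ _ K (m j) e U n cK (mT j) (mK j) mU.
  have icst : (m j).-integrable (K : set (borel T)) (EFin \o (fun=> e)).
    apply: (@bounded_integrable _ _ _ cK _ _ e) => // x _.
    by rewrite gtr0_norm.
  apply: (@le_trans _ _ (pairing K (fun x => phi x + e) (m j))).
    apply: le_Rintegral => //; last by move=> x /sP/andP[].
    exact: (integrableD mmK (iphi _ (mT j) cphi) icst).
  rewrite /pairing RintegralD//; last exact: iphi.
  rewrite lerD2l Rintegral_cst// ler_pM2l//.
  by apply: le_trans (mass_bound (mC j) mmK); exact: ler_norm.
Qed.

Lemma ultra_limit_pairing (phi : T -> R) : {within K, continuous phi} ->
  pairing K phi (m j) @[j --> F] --> pairing K phi nu.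
Proof.
move=> cphi; have mmK := compact_borel cK.
have [B B0 phiB] := within_continuous_bounded cK cphi.
have iphi mu := @within_continuous_integrable _ _ _ cK mu phi.
have icst (mu : {measure set (borel T) -> \bar R}) (r : R) : (mu setT < +oo)%E ->
    mu.-integrable (K : set (borel T)) (EFin \o (fun=> r)).
  by move=> muT; apply: (@bounded_integrable _ _ _ cK _ _ `|r|) => // x _.
have KT (mu : {measure set (borel T) -> \bar R}) : concentrated K mu ->
    mu K = mu setT.
  by move=> muK; rewrite -(concentrated_measureI cK muK measurableT) setTI.
have pairing_shift (mu : {measure set (borel T) -> \bar R}) : (mu setT < +oo)%E ->
    concentrated K mu ->
    pairing K (fun x => B + phi x) mu = B * fine (mu setT) + pairing K phi mu.
  move=> muT muK; rewrite /pairing RintegralD//; [|exact: icst|exact: iphi].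
  by rewrite Rintegral_cst// KT.
have pairing_flip (mu : {measure set (borel T) -> \bar R}) : (mu setT < +oo)%E ->
    concentrated K mu ->
    pairing K (fun x => B - phi x) mu = B * fine (mu setT) - pairing K phi mu.
  move=> muT muK; rewrite /pairing RintegralB//; [|exact: icst|exact: iphi].
  by rewrite Rintegral_cst// KT.
have phi_bnd x : K x -> - B <= phi x <= B by move=> /phiB; rewrite ler_norml.
pose l := lim (pairing K phi (m j) @[j --> F]).
have ml : pairing K phi (m j) @[j --> F] --> l.
  apply: (@ultra_bounded_cvg _ _ _ _ _ (B * C)) => j.
  have mmB : `|pairing K (fun=> B) (m j)| <= B * C.
    rewrite /pairing Rintegral_cst// normrM gtr0_norm// ler_pM2l//.
    exact: mass_bound.
  apply: le_trans (le_normr_Rintegral mmK (iphi _ (mT j) cphi)) _.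
  apply: le_trans (le_trans (ler_norm _) mmB).
  apply: le_Rintegral => //; first exact: integrable_norm (iphi _ (mT j) cphi).
  exact: icst.
suff -> : pairing K phi nu = l by [].
apply/le_anti/andP; split.
  rewrite -(lerD2l (B * fine (nu setT))) -pairing_shift//.
  apply: pairing_limit_le.
  - by move=> x; apply: cvgD; [exact: cvg_cst|exact: cphi].
  - by move=> x /phi_bnd/andP[]; rewrite -subr_ge0 opprK addrC.
  - have -> : (fun j => pairing K (fun x => B + phi x) (m j)) =
              (fun j => B * fine (m j setT) + pairing K phi (m j)).
      by apply/funext => j; rewrite pairing_shift.
    by apply: cvgD => //; apply: cvgM => //; exact: cvg_cst.
rewrite -lerN2 -(lerD2l (B * fine (nu setT))) -pairing_flip//.
apply: pairing_limit_le.
- by move=> x; apply: cvgB; [exact: cvg_cst|exact: cphi].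
- by move=> x /phi_bnd/andP[_]; rewrite subr_ge0.
- have -> : (fun j => pairing K (fun x => B - phi x) (m j)) =
            (fun j => B * fine (m j setT) - pairing K phi (m j)).
    by apply/funext => j; rewrite pairing_flip.
  by apply: cvgB => //; apply: cvgM => //; exact: cvg_cst.
Qed.

End ultra_limit_pairing.

Lemma ultra_weak_star_compact {R : realType} {T : normedModType R} {I : Type}
    {F : set_system I} {UF : UltraFilter F}
    (m : I -> {measure set (borel T) -> \bar R}) (C : R) (K : set T) :
  (forall j, (m j setT <= C%:E)%E) -> compact K ->
  (forall j, concentrated K (m j)) ->
  exists nu : {finite_measure set (borel T) -> \bar R}, concentrated K nu /\
    forall phi : T -> R, {within K, continuous phi} ->
      pairing K phi (m j) @[j --> F] --> pairing K phi nu.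
Proof.
move=> mC cK mK; have [nu [nuK nuT nuO]] := ultra_limit_measure (F := F) mC cK mK.
by exists nu; split => // phi; exact: (ultra_limit_pairing mC).
Qed.

(** * Signed measures and the dual norm *)

Section signed_pairing.
Context {R : realType} {n : nat} (X : set 'rV[R]_n).
Hypothesis cX : compact X.
Local Notation smeas := (charge (borel 'rV[R]_n) R) (only parsing).
Local Notation fmeas := (FiniteMeasure.type (borel 'rV[R]_n) R) (only parsing).

Lemma charge_pairing_sub (phi : 'rV[R]_n -> R) (s : smeas)
    (mu nu : {measure set (borel 'rV[R]_n) -> \bar R}) :
  {within X, continuous phi} -> (mu setT < +oo)%E -> (nu setT < +oo)%E ->
  (forall A : set (borel 'rV[R]_n), measurable A -> s A = (mu A - nu A)%E) ->
  charge_pairing X phi s = pairing X phi mu - pairing X phi nu.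
Proof.
move=> cphi muT nuT sE; rewrite /charge_pairing.
case: cid => P PN; case: cid => Q PQ /=.
have posT : (jordan_pos PQ setT < +oo)%E.
  by rewrite -ge0_fin_numE//; exact: fin_num_measure.
have negT : (jordan_neg PQ setT < +oo)%E.
  by rewrite -ge0_fin_numE//; exact: fin_num_measure.
have H : pairing X phi (measure_add (jordan_pos PQ) nu) =
         pairing X phi (measure_add mu (jordan_neg PQ)).
  apply: eq_pairing_measure => A mA.
  rewrite /= /msum !big_ord_recr/= !big_ord0 !add0e.
  have := jordan_decomp PQ mA; rewrite sE// /cadd/= cscaleN1/=.
  rewrite -(fineK (finite_mass_fin_num muT mA)) -(fineK (finite_mass_fin_num nuT mA)).
  rewrite -(fineK (finite_mass_fin_num posT mA)) -(fineK (finite_mass_fin_num negT mA)).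
  by rewrite -EFinN -!EFinD => -[E]; congr EFin; lra.
move: H; rewrite !pairing_measure_add// => H; lra.
Qed.

Lemma charge_subE (mu nu : fmeas) (A : set (borel 'rV[R]_n)) :
  charge_sub mu nu A = (mu A - nu A)%E.
Proof. by rewrite /charge_sub/= /cadd/= /copp/=. Qed.

Lemma charge_sub_on (mu nu : fmeas) : concentrated X mu -> concentrated X nu ->
  charge_on X (charge_sub mu nu).
Proof.
move=> muX nuX A mA AX; rewrite charge_subE.
have mXC : measurable (~` X : set (borel 'rV[R]_n)).
  by apply: measurableC; exact: compact_borel.
by rewrite (subset_measure0 mA mXC AX muX) (subset_measure0 mA mXC AX nuX) sube0.
Qed.

Lemma pairing_sub_le_dual (N : smeas -> R) (phi : 'rV[R]_n -> R) (mu nu : fmeas) :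
  is_measure_norm X N -> is_finite_norm_on_continuous X (dual_norm X N) ->
  {within X, continuous phi} -> concentrated X mu -> concentrated X nu ->
  `|pairing X phi mu - pairing X phi nu| <=
  fine (dual_norm X N phi) * N (charge_sub mu nu).
Proof.
move=> HN Hdual cphi muX nuX; set s := charge_sub mu nu.
have muT : (mu setT < +oo)%E by rewrite -ge0_fin_numE//; exact: fin_num_measure.
have nuT : (nu setT < +oo)%E by rewrite -ge0_fin_numE//; exact: fin_num_measure.
have sX : charge_on X s by exact: charge_sub_on.
have dfin := continuous_norm_fin Hdual cphi.
have := measure_norm_ge0 HN sX; rewrite le_eqVlt => /orP[/eqP s0|s0].
  have munu (A : set (borel 'rV[R]_n)) : measurable A -> mu A = nu A.
    move=> mA; have := measure_norm_eq0 HN sX (esym s0) mA; rewrite charge_subE.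
    have := @fin_num_measure _ _ _ mu A mA; have := @fin_num_measure _ _ _ nu A mA.
    by case: (mu A) => // a; case: (nu A) => // b _ _ []/eqP; rewrite subr_eq0 => /eqP ->.
  by rewrite (eq_pairing_measure _ _ munu) subrr normr0 -s0 mulr0.
pose r := (N s)^-1.
have r0 : 0 < r by rewrite invr_gt0.
have rsX : charge_on X (cscale r s).
  by move=> A mA AX; rewrite /= /cscale (sX A mA AX) mule0.
have Nrs : N (cscale r s) <= 1.
  by rewrite (measure_normZ HN)// gtr0_norm// mulVf// gt_eqF.
have : (`|charge_pairing X phi (cscale r s)|%:E <= dual_norm X N phi)%E.
  by apply: ereal_sup_ubound; exists (cscale r s).
rewrite (@charge_pairing_sub phi _ (mscale (NngNum (ltW r0)) mu)
  (mscale (NngNum (ltW r0)) nu))//.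
- rewrite !pairing_mscale//= -mulrBr normrM gtr0_norm// -[leRHS]fineK// lee_fin.
  by rewrite /r mulrC ler_pdivrMr.
- by rewrite /= /mscale/= lte_mul_pinfty// ?lee_fin ltW.
- by rewrite /= /mscale/= lte_mul_pinfty// ?lee_fin ltW.
- move=> A mA; rewrite /= /cscale/= /mscale/= charge_subE muleBr// fin_num_adde_defr//.
  exact: fin_num_measure.
Qed.

End signed_pairing.

(** * Test functions *)

Section C1_scaling.
Context {R : realType} {n : nat}.
Implicit Types (v : timestate R n -> R) (A : set (timestate R n)).

Lemma derive_scale v (r : R) (z w : timestate R n) : differentiable v z ->
  'D_w (fun y => r * v y) z = r * 'D_w v z.
Proof. by move=> dv; exact: (deriveZ r (diff_derivable dv)). Qed.

Lemma C1_on_scale A v (r : R) : C1_on A v -> C1_on A (fun z => r * v z).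
Proof.
move=> [W [oW AW vW]]; exists W; split => // z Wz.
have [dv cdt cdx] := vW z Wz.
have nW : nbhs z W by apply: open_nbhs_nbhs; split.
have cD w : {for z, continuous (fun y => 'D_w v y)} ->
    {for z, continuous (fun y => 'D_w (fun y' => r * v y') y)}.
  move=> cw; rewrite /prop_for /continuous_at/= derive_scale//.
  apply: (@cvg_trans _ (r * 'D_w v y @[y --> z])).
    apply: near_eq_cvg; apply: (filterS (P := W)); last exact: nW.
    by move=> y Wy; rewrite derive_scale//; have [] := vW y Wy.
  exact: cvgMl_tmp cw.
split; first exact: (differentiableZ r dv).
- exact: cD.
- by move=> i; exact: (cD _ (cdx i)).
Qed.

Lemma C1_on_continuous A v z : C1_on A v -> A z -> {for z, continuous v}.
Proof.
move=> [W [_ AW vW]] /AW /vW[dv _ _].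
exact: differentiable_continuous.
Qed.

Lemma sup_norm_le A (h : timestate R n -> R) (b : R) : 0 <= b ->
  (forall z, A z -> `|h z| <= b) -> sup_norm A h <= b.
Proof.
move=> b0 hb; rewrite /sup_norm.
have [->|A0] := eqVneq A set0; first by rewrite image_set0 sup0.
apply: ge_sup.
  by move/set0P : A0 => [z Az]; exists `|h z|; exists z.
by move=> _ [z Az <-]; exact: hb.
Qed.

Lemma C1_norm_scale A v : compact A -> C1_on A v ->
  exists2 r : R, 0 < r & C1_norm A (fun z => r * v z) <= 1.
Proof.
move=> cA Av; have [W [oW AW vW]] := Av.
have bnd (h : timestate R n -> R) : (forall z, A z -> {for z, continuous h}) ->
    exists2 B : R, 0 < B & forall z, A z -> `|h z| <= B.
  move=> ch; apply: (@within_continuous_bounded _ _ A cA h).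
  by apply: continuous_in_subspaceT => z /[1!inE]; exact: ch.
have [B0 B0gt vB] := bnd v (fun z => C1_on_continuous Av (z := z)).
have [B1 B1gt dtB] := bnd (dt v) (fun z Az => let: And3 _ c _ := vW z (AW z Az) in c).
have /choice[B2 HB2] : forall i, exists B : R, 0 < B /\
    forall z, A z -> `|dx v i z| <= B.
  move=> i.
  have [|B ? ?] := bnd (dx v i); last by exists B.
  move=> z Az; have [_ _ cdx] := vW z (AW z Az); exact: cdx.
pose B := B0 + B1 + \sum_(i < n) B2 i.
have B2ge0 i : 0 <= B2 i by apply: ltW; have [] := HB2 i.
have Bgt : 0 < B by rewrite ltr_pwDl// ?addr_gt0// sumr_ge0.
exists B^-1; first by rewrite invr_gt0.
have Bi : 0 <= B^-1 by rewrite invr_ge0 ltW.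
have dE w z : A z -> 'D_w (fun y => B^-1 * v y) z = B^-1 * 'D_w v z.
  by move=> /AW/vW[dv _ _]; exact: derive_scale.
have -> : 1 = B^-1 * B0 + B^-1 * B1 + \sum_(i < n) B^-1 * B2 i.
  by rewrite -mulr_sumr -!mulrDr mulVf// gt_eqF.
have sc (h : timestate R n -> R) b z : `|h z| <= b -> `|B^-1 * h z| <= B^-1 * b.
  by move=> hb; rewrite normrM (ger0_norm Bi) ler_wpM2l.
apply: lerD; first apply: lerD.
- apply: sup_norm_le; first by rewrite mulr_ge0// ltW.
  by move=> z /vB; exact: sc.
- apply: sup_norm_le; first by rewrite mulr_ge0// ltW.
  by move=> z Az; rewrite /dt dE//; apply: (sc (dt v)); exact: dtB.
- apply: ler_sum => i _; apply: sup_norm_le; first by rewrite mulr_ge0.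
  move=> z Az; rewrite /dx dE//; apply: (sc (dx v i)).
  by have [_] := HB2 i; exact.
Qed.

End C1_scaling.

(** * Asymptotic feasibility of rollouts *)

Section rollout_bounds.
Context {R : realType} {n d : nat} (pb : om_problem R n d).
Hypothesis Hpb : standing_assumptions pb.
Context (K : nat) (tau : nat -> R).
Hypothesis Htau : is_partition (t0 pb) (tT pb) K tau.
Local Notation X := (stateset pb).

Let cX : compact X := stateset_compact Hpb.

Lemma cylinder_compact : compact (cylinder pb).
Proof. by apply: compact_setX => //; exact: segment_compact. Qed.

Lemma Z_compact : compact (Z pb).
Proof.
by apply: compact_setX; [exact: cylinder_compact|exact: controlset_compact Hpb].
Qed.

Lemma partition_le i j : (i <= j)%N -> (j <= K)%N -> tau i <= tau j.
Proof.
move=> ij jK; rewrite -(subnK ij) addnC in jK *.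
elim: (j - i)%N jK => [|k IHk]; first by rewrite addn0.
rewrite addnS => kK; apply: le_trans (IHk (ltnW kK)) _.
exact/ltW/(partition_increasing Htau).
Qed.

Lemma partition_mem k : (k <= K)%N -> t0 pb <= tau k <= tT pb.
Proof.
by move=> kK; rewrite -(partition_first Htau) -(partition_last Htau) !partition_le.
Qed.

Lemma partition_size_gt0 : (0 < K)%N.
Proof.
rewrite lt0n; apply/eqP => K0.
have := horizon Hpb.
by rewrite -(partition_first Htau) -(partition_last Htau) K0 ltxx.
Qed.

Lemma C1_slice_continuous v k : C1_on (cylinder pb) v -> (k <= K)%N ->
  {within X, continuous (fun x => v (tau k, x))}.
Proof.
move=> Cv kK; apply: continuous_in_subspaceT => x /[1!inE] Xx.
have cv : {for (tau k, x), continuous v}.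
  by apply: C1_on_continuous Cv _; split => //=; rewrite in_itv/= partition_mem.
have cpair : (tau k, y) @[y --> x] --> (tau k, x).
  exact: (@cvg_pair _ _ _ (nbhs x) (nbhs (tau k)) (nbhs x) _ _ _
    (fun=> tau k) id (cvg_cst _) (fun A nA => nA)).
exact: (cvg_comp _ _ cpair cv).
Qed.

Let finite_lty {T : normedModType R}
  (mu : {finite_measure set (borel T) -> \bar R}) : (mu setT < +oo)%E.
Proof. by rewrite -ge0_fin_numE//; exact: fin_num_measure. Qed.

Lemma LfZ v (r : R) z : C1_on (cylinder pb) v -> Z pb z ->
  Lf pb (fun y => r * v y) z = r * Lf pb v z.
Proof.
move=> [W [oW AW vW]] [z1 z2]; have [dv _ _] := vW _ (AW _ z1).
rewrite /Lf mulrDr mulr_sumr /dt derive_scale//; congr (_ + _).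
by apply: eq_bigr => i _; rewrite /dx derive_scale// mulrA.
Qed.

Lemma local_residualZ (r : rollout R n d) v (c : R) k :
  C1_on (cylinder pb) v -> (k < K)%N ->
  local_residual pb tau r k (fun y => c * v y) = c * local_residual pb tau r k v.
Proof.
move=> Cv kK; rewrite /local_residual.
rewrite (pairingZ cX _ (finite_lty _) (C1_slice_continuous Cv kK)).
rewrite (pairingZ cX _ (finite_lty _) (C1_slice_continuous Cv (ltnW kK))).
have -> : pairing (Z pb) (Lf pb (fun y => c * v y)) (occ r k) =
          c * pairing (Z pb) (Lf pb v) (occ r k).
  rewrite -(pairingZ Z_compact _ (finite_lty _) (Lf_continuous Hpb Cv)).
  by apply: eq_Rintegral => z /[1!inE] Zz; exact: LfZ.
by rewrite !mulrBr.
Qed.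

Lemma sum_local_residual (r : rollout R n d) v : C1_on (cylinder pb) v ->
  is_rollout pb K tau r ->
  \sum_(0 <= k < K) local_residual pb tau r k v =
  pairing X (fun x => v (tT pb, x)) (global_terminal K r) -
  pairing X (fun x => v (t0 pb, x)) (mu0 pb) -
  pairing (Z pb) (Lf pb v) (global_occ K r) -
  \sum_(1 <= k < K) (pairing X (fun x => v (tau k, x)) (start r k) -
                     pairing X (fun x => v (tau k, x)) (stop r k)).
Proof.
move=> Cv Hr.
rewrite /global_occ (pairing_msum Z_compact); first last.
- exact: (Lf_continuous Hpb).
- by move=> k _; exact: finite_lty.
rewrite -(eq_pairing_measure _ _ (start_initial Hr)).
rewrite /local_residual /global_terminal -(partition_first Htau) -(partition_last Htau).
move: partition_size_gt0; case: K => // K' _.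
rewrite !sumrB [in LHS]big_nat_recr//= [X in _ - X - _]big_nat_recl//= !big_add1/=.
lra.
Qed.

Lemma global_occ_concentrated (r : rollout R n d) : is_rollout pb K tau r ->
  concentrated (Z pb) (global_occ K r).
Proof.
move=> Hr; rewrite /concentrated /global_occ /= /msum big1// => -[k kK] _ /=.
have kK' : (k < K)%N by [].
have cS : compact (`[tau k, tau k.+1]%classic `*` X `*` controlset pb).
  do 2?apply: compact_setX; [exact: segment_compact|exact: cX|].
  exact: controlset_compact Hpb.
apply: subset_measure0 (occ_concentrated Hr kK').
- by apply: measurableC; exact: (compact_borel Z_compact).
- by apply: measurableC; exact: (compact_borel cS).
- move=> z nZ [[/= z1 Xz] Uz]; apply: nZ; split => //; split => //=.
  move: z1; rewrite !in_itv/= => /andP[tz zt].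
  have /andP[+ _] := partition_mem (ltnW kK'); have /andP[_ +] := partition_mem kK'.
  by move=> h1 h2; rewrite (le_trans h2 tz) (le_trans zt h1).
Qed.

Lemma exactness_gap (N : {charge set (borel 'rV[R]_n) -> \bar R} -> R) v :
  is_measure_norm X N -> is_finite_norm_on_continuous X (dual_norm X N) ->
  C1_on (cylinder pb) v ->
  exists2 a : R, 0 <= a & forall (r : rollout R n d) (e : R),
    is_rollout pb K tau r -> total_defect K N r <= e ->
    (total_residual pb K tau r <= e%:E)%E ->
    `|pairing X (fun x => v (tT pb, x)) (global_terminal K r) -
      pairing X (fun x => v (t0 pb, x)) (mu0 pb) -
      pairing (Z pb) (Lf pb v) (global_occ K r)| <= a * e.
Proof.
move=> HN Hdual Cv.
have [c c0 vc] := C1_norm_scale cylinder_compact Cv.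
pose q k := fine (dual_norm X N (fun x => v (tau k, x))).
have q0 k : (k < K)%N -> 0 <= q k.
  move=> kK; apply: fine_ge0; apply: (continuous_norm_ge0 Hdual).
  exact/C1_slice_continuous/ltnW.
have sq0 : 0 <= \sum_(1 <= k < K) q k.
  by rewrite big_nat_cond sumr_ge0// => k /andP[/andP[_ kK] _]; exact: q0.
exists (c^-1 + \sum_(1 <= k < K) q k); first by rewrite addr_ge0// invr_ge0 ltW.
move=> r e Hr He Hres.
have := sum_local_residual Cv Hr.
set s := \sum_(0 <= k < K) _; set g := pairing X _ _ - _ - _; set D := \sum_(1 <= k < K) _.
move=> sE; have -> : g = s + D by rewrite sE subrK.
apply: le_trans (ler_normD _ _) _; rewrite mulrDl; apply: lerD.
  rewrite ler_pdivlMl// -lee_fin; apply: le_trans Hres.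
  rewrite -[X in X * _](gtr0_norm c0) -normrM.
  have -> : c * s = \sum_(0 <= k < K) local_residual pb tau r k (fun y => c * v y).
    rewrite /s mulr_sumr; apply: eq_big_nat => k /andP[_ kK].
    by rewrite local_residualZ.
  exact: (ereal_sup_ubound (ex_intro2 _ _ (fun y => c * v y)
    (conj (C1_on_scale c Cv) vc) erefl)).
have defect_ge0 k : (0 < k < K)%N -> 0 <= N (interface_defect r k).
  move=> /andP[k0 kK]; apply/(measure_norm_ge0 HN)/(charge_sub_on cX).
    exact: (start_concentrated Hr kK).
  have := @stop_concentrated _ _ _ _ _ _ _ Hr k.-1; rewrite prednK//; apply.
  exact: ltnW.
apply: (@le_trans _ _ (\sum_(1 <= k < K) q k * N (interface_defect r k))).
  apply: le_trans (ler_norm_sum _ _ _) _.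
  apply: ler_sum_nat => k /andP[k0 kK]; apply: pairing_sub_le_dual => //.
  - exact/C1_slice_continuous/ltnW.
  - exact: (start_concentrated Hr kK).
  - have := @stop_concentrated _ _ _ _ _ _ _ Hr k.-1; rewrite prednK//; apply.
    exact: ltnW.
rewrite mulr_suml; apply: ler_sum_nat => k k0K.
have kK : (k < K)%N by case/andP : k0K.
rewrite ler_wpM2l// ?q0//; apply: le_trans He.
rewrite /total_defect (bigD1_seq k)/= ?mem_index_iota ?iota_uniq//.
rewrite lerDl big_seq_cond sumr_ge0// => i; rewrite mem_index_iota => /andP[iK _].
exact: defect_ge0.
Qed.

End rollout_bounds.

Lemma limit_of_rollouts_feasible {R : realType} {n d : nat} (pb : om_problem R n d)
    (K : nat) (tau : nat -> R)
    (N : {charge set (borel 'rV[R]_n) -> \bar R} -> R)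
    (r : nat -> rollout R n d) (C c : R) :
  standing_assumptions pb -> is_partition (t0 pb) (tT pb) K tau ->
  is_measure_norm (stateset pb) N ->
  is_finite_norm_on_continuous (stateset pb) (dual_norm (stateset pb) N) ->
  (forall j, is_rollout pb K tau (r j)) ->
  (forall j, (global_occ K (r j) setT <= C%:E)%E) ->
  (forall j, (global_terminal K (r j) setT <= C%:E)%E) ->
  (forall j, total_defect K N (r j) <= j.+1%:R^-1) ->
  (forall j, (total_residual pb K tau (r j) <= (j.+1%:R^-1)%:E)%E) ->
  (forall j, rollout_cost pb K (r j) <= c) ->
  exists mu muT, exact_feasible pb mu muT /\ cost pb mu muT <= c.
Proof.
move=> Hpb Htau HN Hdual Hr occC termC Hdef Hres Hcost.
have [F [UF ooF]] := ultraFilterLemma (F := (\oo : set_system nat)) _.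
have cX := stateset_compact Hpb.
have [mu [muZ cvg_mu]] := ultra_weak_star_compact (F := F) occC (Z_compact Hpb)
  (fun j => global_occ_concentrated Hpb Htau (Hr j)).
have K0 := partition_size_gt0 Hpb Htau.
have termX j : concentrated (stateset pb) (global_terminal K (r j)).
  have := @stop_concentrated _ _ _ _ _ _ _ (Hr j) K.-1; rewrite prednK//; exact.
have [muT [muTX cvg_muT]] := ultra_weak_star_compact (F := F) termC cX termX.
exists mu, muT; split; last first.
  apply: (@ler_cvg_index _ _ F _ (fun j => rollout_cost pb K (r j)) (fun=> c)) => //.
    apply: cvgD; first exact: cvg_mu (running_continuous Hpb).
    exact: cvg_muT (terminal_continuous Hpb).
  exact: cvg_cst.
split => // v Cv.
have [a a0 gap] := exactness_gap Hpb Htau HN Hdual Cv.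
pose g j := pairing (stateset pb) (fun x => v (tT pb, x)) (global_terminal K (r j)) -
  pairing (stateset pb) (fun x => v (t0 pb, x)) (mu0 pb) -
  pairing (Z pb) (Lf pb v) (global_occ K (r j)).
have cvT : {within stateset pb, continuous (fun x => v (tT pb, x))}.
  by rewrite -(partition_last Htau); exact: C1_slice_continuous Cv (leqnn K).
have cvg_g : g j @[j --> F] -->
    pairing (stateset pb) (fun x => v (tT pb, x)) muT -
    pairing (stateset pb) (fun x => v (t0 pb, x)) (mu0 pb) -
    pairing (Z pb) (Lf pb v) mu.
  apply: cvgB; last exact: cvg_mu (Lf_continuous Hpb Cv).
  by apply: cvgB; [exact: cvg_muT cvT|exact: cvg_cst].
apply/eqP; rewrite -subr_eq0 -normr_le0.
apply: (@ler_cvg_index _ _ F _ (fun j => `|g j|) (fun j => a * j.+1%:R^-1)).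
- exact: cvg_norm.
- rewrite -(mulr0 a); apply: cvgMl_tmp.
  by apply: cvg_trans (@cvg_harmonic R) => A /= hA; exact: ooF.
- by move=> j; exact: gap.
Qed.

Theorem theorem2 (R : realType) (n d : nat) (pb : om_problem R n d)
    (Hpb : standing_assumptions pb)
    (K : nat) (tau : nat -> R) (Htau : is_partition (t0 pb) (tT pb) K tau)
    (N : {charge set (borel 'rV[R]_n) -> \bar R} -> R)
    (HN : is_measure_norm (stateset pb) N)
    (HNdual : is_finite_norm_on_continuous (stateset pb)
                (dual_norm (stateset pb) N))
    (Par : Type) (roll : Par -> rollout R n d) (Theta : nat -> set Par)
    (Hfam : is_rollout_family pb K tau roll Theta)
    (Hnested : nested_capacity Theta)
    (Hdense : asymptotically_dense pb K tau roll Theta N) :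
  exists (P1 : R -> R -> \bar R) (P2 : R -> \bar R),
    [/\ forall eta delta : R, 0 < eta -> 0 < delta ->
          P_imp pb K tau roll Theta N M eta delta @[M --> \oo]
            --> P1 eta delta,
        forall delta : R, 0 < delta ->
          P1 eta delta @[eta --> 0^'+] --> P2 delta &
        P2 delta @[delta --> 0^'+] --> OM_value pb].
Proof.
pose Pi M eta delta := P_imp pb K tau roll Theta N M.+1 eta delta.
pose P1 eta delta := ereal_inf (range (fun M => Pi M eta delta)).
pose pos := [set` Interval (BRight (0 : R)) +oo%O].
pose P2 delta := ereal_sup [set P1 eta delta | eta in pos].
have posE x : pos x = (0 < x) :> Prop by rewrite /pos/= in_itv/= andbT.
have Pi_le M eta delta eta' delta' : eta <= eta' -> delta <= delta' ->
    (Pi M eta' delta' <= Pi M eta delta)%E.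
  move=> ee dd; apply: ereal_inf_le_tmp => _ [th [? De Ed] <-]; exists th => //.
  by split => //; [exact: le_trans ee|apply: le_trans Ed _; rewrite lee_fin].
have P1_le eta delta eta' delta' : eta <= eta' -> delta <= delta' ->
    (P1 eta' delta' <= P1 eta delta)%E.
  move=> ee dd; apply: le_ereal_inf_tmp => _ [M _ <-].
  by apply: ge_ereal_inf; exists (Pi M eta' delta'); [exists M|exact: Pi_le].
have P2_le delta delta' : delta <= delta' -> (P2 delta' <= P2 delta)%E.
  move=> dd; apply: ge_ereal_sup => _ [eta eta0 <-].
  by apply: le_ereal_sup_tmp; exists (P1 eta delta); [exists eta|exact: P1_le].
exists P1, P2; split.
- move=> eta delta _ _; rewrite -cvg_shiftS.
  apply: ereal_nonincreasing_cvgn; apply/nonincreasing_seqP => M.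
  apply: ereal_inf_le_tmp => _ [th [? ? ?] <-]; exists th => //; split => //.
  exact: Hnested.
- move=> delta _; apply: nonincreasing_at_right_cvge; first by rewrite bnd_simp.
  by move=> x y _ _ xy; exact: P1_le.
suff -> : OM_value pb = ereal_sup [set P2 delta | delta in pos].
  apply: nonincreasing_at_right_cvge; first by rewrite bnd_simp.
  by move=> x y _ _ xy; exact: P2_le.
apply/le_anti/andP; split; last first.
  apply: ge_ereal_sup => y [delta]; rewrite posE => delta0 <- {y}.
  apply: ge_ereal_sup => y [eta]; rewrite posE => eta0 <- {y}.
  apply: le_ereal_inf_tmp => _ [mu [muT [feas ->]]].
  have [th [thM occ_cvg term_cvg def_cvg res_cvg]] := Hdense _ _ feas.
  have cost_cvg : (rollout_cost pb K (roll (th M)))%:E @[M --> \oo] -->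
      (cost pb mu muT)%:E.
    apply: cvg_EFin; first exact: nearW.
    apply: cvgD; first exact: occ_cvg (running_continuous Hpb).
    exact: term_cvg (terminal_continuous Hpb).
  have near_res : \forall M \near \oo,
      (total_residual pb K tau (roll (th M)) < delta%:E)%E.
    apply: (res_cvg [set x | (x < delta%:E)%E]).
    by apply: open_nbhs_nbhs; split; [exact: open_ereal_lt_ereal|rewrite /= lte_fin].
  apply: (cvge_ge _ cost_cvg).
  near=> M.
  have M0 : (0 < M)%N by near: M; exact: nbhs_infty_gt.
  apply: ge_ereal_inf; exists (Pi M.-1 eta delta); first by exists M.-1.
  apply: ereal_inf_lbound; exists (th M) => //; split.
  + by rewrite prednK//; exact: thM.
  + by near: M; apply: cvgr_le def_cvg _ eta0.
  + by apply: ltW; near: M; exact: near_res.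
have [C HC] := family_mass_bounded Hfam.
have key c : (ereal_sup [set P2 delta | delta in pos] < c%:E)%E ->
    (OM_value pb <= c%:E)%E.
  move=> Sc.
  have /choice[th thP] : forall j : nat, exists t, [/\ exists2 M, (1 <= M)%N & Theta M t,
      total_defect K N (roll t) <= j.+1%:R^-1,
      (total_residual pb K tau (roll t) <= (j.+1%:R^-1)%:E)%E &
      rollout_cost pb K (roll t) <= c].
    move=> j; pose e : R := j.+1%:R^-1.
    have e0 : pos e by rewrite posE invr_gt0.
    have : (P1 e e < c%:E)%E.
      apply: le_lt_trans Sc; apply: le_ereal_sup_tmp.
      exists (P2 e); first by exists e.
      by apply: ereal_sup_ubound; exists e.
    move=> /ereal_inf_lt[_ [M _ <-]] /ereal_inf_lt[_ [t [tM tD tE] <-]] tc.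
    exists t; split => //; first by exists M.+1.
    by rewrite ltW// -lte_fin.
  have roll_th j : is_rollout pb K tau (roll (th j)).
    by have [[M M1 tM] _ _ _] := thP j; exact: family_rollout Hfam _ _ M1 tM.
  have [mass_occ mass_term] : (forall j, global_occ K (roll (th j)) setT <= C%:E)%E /\
      (forall j, global_terminal K (roll (th j)) setT <= C%:E)%E.
    by split=> j; have [[M M1 tM] _ _ _] := thP j; have [] := HC M _ M1 tM.
  have [mu [muT [feas le_c]]] :=
    @limit_of_rollouts_feasible R n d pb K tau N (roll \o th) C c Hpb Htau HN
      HNdual roll_th mass_occ mass_term (fun j => let: And4 _ h _ _ := thP j in h)
      (fun j => let: And4 _ _ h _ := thP j in h)
      (fun j => let: And4 _ _ _ h := thP j in h).
  apply: ge_ereal_inf; exists (cost pb mu muT)%:E; last by rewrite lee_fin.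
  by exists mu, muT.
move: key; case: (ereal_sup _) => [s| |] key.
- apply/lee_addgt0Pr => e e0; rewrite -EFinD; apply: key.
  by rewrite lte_fin ltrDl.
- exact: leey.
- by rewrite leeNy_eq; apply/eqP/eq_ninfty => A; apply: key; exact: ltNyr.
Unshelve. all: by end_near.
Qed.
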